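(* Let the Ramanujan polynomials $R_n(x)$, $n\ge 1$, be defined by $$R_1(x)=1,\qquad R_{n+1}(x)=n(1+x)R_n(x)+x^2R_n'(x)\quad (n\ge 1),$$ where $R_n'$ is the derivative of $R_n$ with respect to $x$. Then the sequence $\{R_n(q)\}_{n\ge 1}$ is strongly $q$-log-convex; that is, for all integers $n\ge m\ge 2$, the polynomial $R_{m-1}(q)R_{n+1}(q)-R_m(q)R_n(q)$ has only nonnegative coefficients.
   Context: For real polynomials, $f(q)\ge_q g(q)$ means that $f(q)-g(q)$ has only nonnegative coefficients. A sequence of real polynomials $\{f_n(q)\}_{n\ge 0}$ is strongly $q$-log-convex if $f_{m-1}(q)f_{n+1}(q)\ge_q f_m(q)f_n(q)$ for all $n\ge m\ge 1$. The Ramanujan polynomials are indexed starting from $1$, so this is applied with $f_n=R_{n+1}$. *)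

(* Defs.v *)
From mathcomp Require Import all_boot all_order all_algebra.
From mathcomp Require Import reals.

Set Implicit Arguments.
Unset Strict Implicit.
Unset Printing Implicit Defensive.

Import Order.TTheory GRing.Theory Num.Theory.
Local Open Scope ring_scope.

Definition qge (R : realType) (f g : {poly R}) : Prop :=
  forall i : nat, 0 <= (f - g)`_i.

Definition strongly_q_log_convex (R : realType) (f : nat -> {poly R}) : Prop :=
  forall m n : nat, (1 <= m)%N -> (m <= n)%N ->
    qge (f m.-1 * f n.+1) (f m * f n).

(* The polynomials are indexed from 1; the value at 0 is a dummy that does not
   enter the recurrence. *)
Fixpoint ramanujan (R : realType) (n : nat) : {poly R} :=
  match n with
  | 0 => 0
  | 1 => 1
  | n'.+1 => n'%:R * (1 + 'X) * ramanujan R n' + 'X^2 * (ramanujan R n')^`()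
  end.

(* Main.v *)
(** Write [R_n] for the [n]-th polynomial.  Eliminating [R_{a+1}] and [R_{b+1}]
    with the recurrence gives
    [R_a R_{b+1} - R_{a+1} R_b
       = (b - a) (1 + x) R_a R_b + x^2 (R_a R_b' - R_a' R_b)],
    so for [a <= b] it suffices that the Wronskian has nonnegative coefficients.
    Symmetrising, twice its coefficient at [x^(k-1)] is
    [\sum_(i + j = k) (j - i) (r(a,i) r(b,j) - r(a,j) r(b,i))], and every term is
    nonnegative as soon as the coefficient array [r] is totally positive of
    order 2.  The recurrence [r(n+1,k) = n r(n,k) + (n+k-1) r(n,k-1)] preserves
    log-concavity of the rows, and log-concavity of the rows gives total
    positivity by induction on the lower row. *)
Require Import Defs.
From mathcomp Require Import all_boot all_order all_algebra.
From mathcomp Require Import reals.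
From mathcomp Require Import zify ring.

Set Implicit Arguments.
Unset Strict Implicit.
Unset Printing Implicit Defensive.

Import Order.TTheory GRing.Theory Num.Theory.

(* Row [n] lists the coefficients of [ramanujan R n.+1]. *)
Fixpoint ramanujan_coef (n k : nat) : nat :=
  match n, k with
  | 0, _ => k == 0
  | n'.+1, 0 => n * ramanujan_coef n' 0
  | n'.+1, k'.+1 => n * ramanujan_coef n' k'.+1 + (n + k') * ramanujan_coef n' k'
  end.

Lemma ramanujan_coefS0 n :
  ramanujan_coef n.+1 0 = n.+1 * ramanujan_coef n 0.
Proof. by []. Qed.

Lemma ramanujan_coefSS n k :
  ramanujan_coef n.+1 k.+1 =
  n.+1 * ramanujan_coef n k.+1 + (n.+1 + k) * ramanujan_coef n k.
Proof. by []. Qed.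

Lemma ramanujan_coef_gt0 n k : (0 < ramanujan_coef n k) = (k <= n).
Proof.
elim: n k => [|n IHn] [|k] //.
  by rewrite ramanujan_coefS0 muln_gt0 IHn.
rewrite ramanujan_coefSS addn_gt0 !muln_gt0 !IHn addSn /= ltnS.
by case: (ltnP k n) => // /ltnW ->.
Qed.

(** Expanding even an adjacent pair by the recurrence produces pairs of indices further apart, so
    the induction carries all [i <= j]. *)
Lemma ramanujan_coef_logconcave n i j : i <= j ->
  ramanujan_coef n i * ramanujan_coef n j.+1
  <= ramanujan_coef n i.+1 * ramanujan_coef n j.
Proof.
elim: n i j => [|n IHn] i j le_ij; first by rewrite muln0.
case: j le_ij => [|j] le_ij.
  by move: le_ij; rewrite leqn0 => /eqP ->; rewrite mulnC.
set u := ramanujan_coef n in IHn *.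
case: i le_ij => [|i] le_ij.
  rewrite ramanujan_coefS0 !ramanujan_coefSS -/u.
  (* After cancellation [u 0 * u j.+1] keeps weight [n.+1 * j.+1], which [h2] can absorb because
     [j.+1 <= n.+1 + j]. *)
  have h1 := IHn 0 j.+1 isT; have h2 := IHn 0 j isT.
  have := leq_mul (leqnn (n.+1 * n.+1)) h1.
  have := leq_mul (leqnn (n.+1 * j.+1)) h2.
  have : n.+1 * j.+1 * (u 1 * u j) <= n.+1 * (n.+1 + j) * (u 1 * u j) by nia.
  lia.
rewrite !ramanujan_coefSS -/u.
have h1 := IHn i.+1 j.+1 le_ij; have h2 := IHn i j le_ij.
(* These are the cross terms, divided by [n.+1]. For [i = j] the bound on [u i.+1 * u j.+1] may
   fail, but its weight [j - i] vanishes. *)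
have h3 : (j - i) * (u i.+1 * u j.+1) + (n.+1 + i) * (u i * u j.+2)
          <= (n.+1 + j) * (u i.+2 * u j).
  move: le_ij; rewrite ltnS leq_eqVlt => /orP[/eqP <-|lt_ij].
    by rewrite subnn (mulnC (u i.+2)).
  have h4 := IHn _ _ lt_ij; have h5 := IHn i j.+1 (leqW (ltnW lt_ij)).
  have -> : n.+1 + j = (j - i) + (n.+1 + i) by lia.
  rewrite [leqRHS]mulnDl leq_add // leq_mul2l ?h4 ?orbT //.
  by rewrite (leq_trans h5 h4) orbT.
have := leq_mul (leqnn (n.+1 * n.+1)) h1.
have := leq_mul (leqnn ((n.+1 + i) * (n.+1 + j.+1))) h2.
have := leq_mul (leqnn n.+1) h3.
have [d ->] : exists d, j = (i + d)%N by exists (j - i); rewrite subnKC.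
rewrite addKn.
nia.
Qed.

Lemma ramanujan_coef_TP2 a b i j : a <= b -> i <= j ->
  ramanujan_coef a j * ramanujan_coef b i
  <= ramanujan_coef a i * ramanujan_coef b j.
Proof.
move=> le_ab; elim: b i j le_ab => [|b IHb] i j.
  by rewrite leqn0 => /eqP -> _; rewrite mulnC.
rewrite leq_eqVlt => /orP[/eqP -> _|]; first by rewrite mulnC.
rewrite ltnS => le_ab le_ij.
case: j le_ij => [|j] le_ij; first by move: le_ij; rewrite leqn0 => /eqP ->.
have IH i' := IHb i' j.+1 le_ab.
case: i le_ij => [|i] le_ij.
  rewrite ramanujan_coefS0 ramanujan_coefSS mulnDr !(mulnCA _ b.+1).
  apply: leq_trans (leq_addr _ _); exact: leq_mul (leqnn _) (IH _ le_ij).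
rewrite !ramanujan_coefSS [leqLHS]mulnDr [leqRHS]mulnDr.
rewrite !(mulnCA (ramanujan_coef a _)).
apply: leq_add; first by rewrite leq_mul2l IH ?orbT.
apply: leq_mul; first by rewrite leq_add2l -ltnS.
(* If [b < i.+1], then [a <= b] makes the left side zero. Otherwise multiply by the positive
   [ramanujan_coef b i.+1]: the induction hypothesis, then log-concavity of row [b], give the
   bound. *)
have [lt_bi|le_ib] := ltnP b i.+1.
  have : ~~ (0 < ramanujan_coef a j.+1) by rewrite ramanujan_coef_gt0; lia.
  by rewrite lt0n negbK => /eqP ->.
rewrite -(leq_pmul2r (_ : 0 < ramanujan_coef b i.+1)) ?ramanujan_coef_gt0 //.
rewrite mulnAC (leq_trans (leq_mul (IH _ le_ij) (leqnn _))) //.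
rewrite -!mulnA leq_mul2l [X in _ <= X]mulnC [X in X <= _]mulnC.
by rewrite ramanujan_coef_logconcave ?orbT.
Qed.

Local Open Scope ring_scope.

Lemma ramanujanSS (R : realType) n :
  ramanujan R n.+2 = n.+1%:R * (1 + 'X) * ramanujan R n.+1
                     + 'X^2 * (ramanujan R n.+1)^`().
Proof. by []. Qed.

Lemma coef_ramanujan (R : realType) n k :
  (ramanujan R n.+1)`_k = (ramanujan_coef n k)%:R.
Proof.
elim: n k => [|n IHn] k; first by rewrite coef1.
rewrite ramanujanSS; move: (ramanujan R n.+1) IHn => p IHp.
rewrite -mulrA mulrDl mul1r expr2 -mulrA mulr_natl coefD coefMn coefD !coefXM.
case: k => [|k].
  by rewrite ramanujan_coefS0 natrM -IHp mulr_natl /= !addr0.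
rewrite ramanujan_coefSS natrD !natrM natrD -!IHp.
case: k => [|k] /=; first by rewrite !addr0 mulrnDl !mulr_natl.
rewrite coef_deriv; ring.
Qed.

Lemma coef_wronskian_ge0 (R : numDomainType) (p q : {poly R}) k :
  (forall i j, (i <= j)%N -> p`_j * q`_i <= p`_i * q`_j) ->
  0 <= (p * q^`() - p^`() * q)`_k.
Proof.
move=> TP2.
have coefXd (f : {poly R}) i : ('X * f^`())`_i = f`_i *+ i.
  by rewrite coefXM; case: i => [|i]; rewrite ?mulr0n // coef_deriv.
(* The extra ['X] turns each derivative into the Euler operator, which scales the coefficient at [i]
   by [i] without shifting it. *)
have -> : (p * q^`() - p^`() * q)`_k = ('X * (p * q^`() - p^`() * q))`_k.+1.
  by rewrite coefXM.
have -> : 'X * (p * q^`() - p^`() * q) = p * ('X * q^`()) - ('X * p^`()) * q.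
  ring.
rewrite coefB !coefM -sumrB; set S := \sum_(i < _) _.
suff : 0 <= S *+ 2 by rewrite pmulrn_lge0.
rewrite mulr2n [X in _ + X](reindex_inj rev_ord_inj) -big_split /=.
apply: sumr_ge0 => i _; rewrite !coefXd subSS.
have le_ik : (i <= k.+1)%N by rewrite -ltnS.
rewrite subKn //; set j := (k.+1 - i)%N.
have -> : p`_i * (q`_j *+ j) - p`_i *+ i * q`_j + (p`_j * (q`_i *+ i) - p`_j *+ j * q`_i)
   = (j%:R - i%:R) * (p`_i * q`_j - p`_j * q`_i) by ring.
case/orP: (leq_total i j) => le_ij.
  by apply: mulr_ge0; rewrite subr_ge0 ?ler_nat // TP2.
by apply: mulr_le0; rewrite subr_le0 ?ler_nat // TP2.
Qed.

Theorem corollary3p3 (R : realType) :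
  strongly_q_log_convex (fun n : nat => ramanujan R n.+1).
Proof.
move=> [//|a] n _ lt_an k.
rewrite -[_.-1]/a !ramanujanSS.
set p := ramanujan R a.+1; set q := ramanujan R n.+1.
have -> : p * (n.+1%:R * (1 + 'X) * q + 'X^2 * q^`())
          - (a.+1%:R * (1 + 'X) * p + 'X^2 * p^`()) * q
   = (1 + 'X) * (p * q) *+ (n - a) + 'X * ('X * (p * q^`() - p^`() * q)).
  by rewrite -[_ *+ (n - a)]mulr_natl natrB 1?ltnW //; ring.
rewrite coefD addr_ge0 //.
  have pq_ge0 i : 0 <= (p * q)`_i.
    rewrite coefM; apply: sumr_ge0 => j _.
    by rewrite !coef_ramanujan mulr_ge0 ?ler0n.
  rewrite coefMn mulrn_wge0 // mulrDl mul1r coefD coefXM addr_ge0 //.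
  by case: ifP.
rewrite !coefXM; case: k => [|[|k]] //=.
apply: coef_wronskian_ge0 => i j le_ij.
by rewrite !coef_ramanujan -!natrM ler_nat ramanujan_coef_TP2 //; lia.
Qed.
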